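(* Let $\mathsf{H}$ be a right quaternionic Hilbert space and $T\in\mathfrak{B}(\mathsf{H})$. If $T\in GCSI(\mathsf{H})$, then $T$ is paranormal, i.e. $\|Tx\|^2\leq\|T^2x\|\,\|x\|$ for every $x\in\mathsf{H}$.
   Context: $\mathbb{H}$ is the skew field of quaternions. A right quaternionic Hilbert space $\mathsf{H}$ is a right vector space over $\mathbb{H}$ with an inner product $\langle\cdot,\cdot\rangle:\mathsf{H}\times\mathsf{H}\to\mathbb{H}$ satisfying $\overline{\langle u,v\rangle}=\langle v,u\rangle$, $\langle u,u\rangle>0$ for $u\neq 0$, and $\langle u,vp+wq\rangle=\langle u,v\rangle p+\langle u,w\rangle q$ for $u,v,w\in\mathsf{H}$, $p,q\in\mathbb{H}$, complete in the norm $\|u\|=\sqrt{\langle u,u\rangle}$. $\mathfrak{B}(\mathsf{H})$ is the set of bounded right linear operators $T:\mathsf{H}\to\mathsf{H}$, i.e. $T(up+v)=(Tu)p+Tv$. $T\in GCSI(\mathsf{H})$ ($T$ satisfies the generalized Cauchy-Schwarz inequality) means: there are $\beta\in(0,1]$ and $\alpha=1-\beta$ (not depending on $x,y$) such that $|\langle Tx,y\rangle|\leq(\|Tx\|\,\|y\|)^{\alpha}(\|Ty\|\,\|x\|)^{\beta}$ for every $x,y\in\mathsf{H}$ (with $t^0=1$). *)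

(* Defs.v *)
From HB Require Import structures.
From mathcomp Require Import all_boot all_order all_algebra.
From mathcomp Require Import ring.
From mathcomp Require Import reals exp.

Set Implicit Arguments.
Unset Strict Implicit.
Unset Printing Implicit Defensive.

Import Order.TTheory GRing.Theory Num.Theory.

Local Open Scope ring_scope.

(* Quat a b c d is a + b i + c j + d k. *)
Record quat (R : Type) := Quat { q0 : R; q1 : R; q2 : R; q3 : R }.

Section QuatRing.
Variable R : realFieldType.
Local Notation Q := (quat R).

Definition quat_tuple (x : Q) : R * R * R * R := (q0 x, q1 x, q2 x, q3 x).
Definition tuple_quat (t : R * R * R * R) : Q :=
  let: (a, b, c, d) := t in Quat a b c d.
Lemma quat_tupleK : cancel quat_tuple tuple_quat.
Proof. by case. Qed.

HB.instance Definition _ := Choice.copy Q (can_type quat_tupleK).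

Definition quat_zero : Q := Quat 0 0 0 0.
Definition quat_opp (x : Q) : Q :=
  Quat (- q0 x) (- q1 x) (- q2 x) (- q3 x).
Definition quat_add (x y : Q) : Q :=
  Quat (q0 x + q0 y) (q1 x + q1 y) (q2 x + q2 y) (q3 x + q3 y).

Lemma quat_addA : associative quat_add.
Proof. by move=> x y z; rewrite /quat_add /= !addrA. Qed.
Lemma quat_addC : commutative quat_add.
Proof. by move=> x y; congr Quat; rewrite addrC. Qed.
Lemma quat_add0 : left_id quat_zero quat_add.
Proof. by case=> a b c d; rewrite /quat_add /= !add0r. Qed.
Lemma quat_addN : left_inverse quat_zero quat_opp quat_add.
Proof. by move=> x; rewrite /quat_add /= !addNr. Qed.

HB.instance Definition _ :=
  GRing.isZmodule.Build Q quat_addA quat_addC quat_add0 quat_addN.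

Definition quat_one : Q := Quat 1 0 0 0.

(* Hamilton's product: i^2 = j^2 = k^2 = i j k = -1. *)
Definition quat_mul (x y : Q) : Q :=
  Quat (q0 x * q0 y - q1 x * q1 y - q2 x * q2 y - q3 x * q3 y)
       (q0 x * q1 y + q1 x * q0 y + q2 x * q3 y - q3 x * q2 y)
       (q0 x * q2 y - q1 x * q3 y + q2 x * q0 y + q3 x * q1 y)
       (q0 x * q3 y + q1 x * q2 y - q2 x * q1 y + q3 x * q0 y).

Lemma quat_mulA : associative quat_mul.
Proof. by move=> x y z; congr Quat => /=; ring. Qed.
Lemma quat_mul1l : left_id quat_one quat_mul.
Proof. by case=> a b c d; congr Quat => /=; ring. Qed.
Lemma quat_mul1r : right_id quat_one quat_mul.
Proof. by case=> a b c d; congr Quat => /=; ring. Qed.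
Lemma quat_mulDl : left_distributive quat_mul +%R.
Proof. by move=> x y z; congr Quat => /=; ring. Qed.
Lemma quat_mulDr : right_distributive quat_mul +%R.
Proof. by move=> x y z; congr Quat => /=; ring. Qed.
Lemma quat_one_neq0 : quat_one != 0.
Proof. by apply/eqP => -[] /eqP; rewrite oner_eq0. Qed.

HB.instance Definition _ := GRing.Zmodule_isNzRing.Build Q
  quat_mulA quat_mul1l quat_mul1r quat_mulDl quat_mulDr quat_one_neq0.

Definition real_quat (r : R) : Q := Quat r 0 0 0.

Definition quat_conj (x : Q) : Q :=
  Quat (q0 x) (- q1 x) (- q2 x) (- q3 x).

Definition quat_normsq (x : Q) : R :=
  q0 x ^+ 2 + q1 x ^+ 2 + q2 x ^+ 2 + q3 x ^+ 2.

Definition quat_inv (x : Q) : Q :=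
  if x == 0 then x else real_quat (quat_normsq x)^-1 * quat_conj x.

Lemma quat_normsq_eq0 (x : Q) : (quat_normsq x == 0) = (x == 0).
Proof.
apply/eqP/eqP => [|->]; last by rewrite /quat_normsq /=; ring.
case: x => a b c d; rewrite /quat_normsq /= => /eqP.
rewrite !paddr_eq0 ?addr_ge0 ?sqr_ge0// !sqrf_eq0.
by move=> /andP[/andP[/andP[/eqP-> /eqP->] /eqP->] /eqP->].
Qed.

Lemma quat_mulV : {in [pred x | x != 0], left_inverse 1 quat_inv *%R}.
Proof.
move=> x; rewrite inE => x0; rewrite /quat_inv (negbTE x0).
move: x0; rewrite -quat_normsq_eq0 /quat_normsq => x0.
by congr Quat => /=; field.
Qed.
Lemma quat_divV : {in [pred x | x != 0], right_inverse 1 quat_inv *%R}.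
Proof.
move=> x; rewrite inE => x0; rewrite /quat_inv (negbTE x0).
move: x0; rewrite -quat_normsq_eq0 /quat_normsq => x0.
by congr Quat => /=; field.
Qed.
Lemma quat_unitP (x y : Q) : y * x = 1 /\ x * y = 1 -> [pred z | z != 0] x.
Proof.
by case=> _ xy /=; apply/eqP => x0; move/eqP: xy; rewrite x0 mul0r eq_sym oner_eq0.
Qed.
Lemma quat_inv_out : {in [predC [pred x : Q | x != 0]], quat_inv =1 id}.
Proof. by move=> x; rewrite !inE negbK /quat_inv => ->. Qed.

(* Every nonzero element is a unit, i.e. quat R is a skew field. *)
HB.instance Definition _ := GRing.NzRing_hasMulInverse.Build Q
  quat_mulV quat_divV quat_unitP quat_inv_out.

End QuatRing.

Definition quat_abs (R : rcfType) (x : quat R) : R := Num.sqrt (quat_normsq x).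

(* A right vector space over the quaternions is a left module over the converse
   ring (quat R)^c; rscale u p is the product u p. *)
Definition rscale (R : realFieldType) (H : lmodType (quat R)^c)
  (u : H) (p : quat R) : H := (p : (quat R)^c) *: u.

Lemma rscaleA (R : realFieldType) (H : lmodType (quat R)^c) (u : H)
  (p q : quat R) : rscale (rscale u p) q = rscale u (p * q).
Proof. exact: scalerA. Qed.

Definition hilbert_norm (R : rcfType) (H : Type) (ip : H -> H -> quat R)
  (u : H) : R := Num.sqrt (q0 (ip u u)).

Definition norm_complete (R : rcfType) (H : zmodType) (N : H -> R) : Prop :=
  forall u : nat -> H,
    (forall e : R, 0 < e ->
       exists n0 : nat, forall m n : nat,
         (n0 <= m)%N -> (n0 <= n)%N -> N (u m - u n) < e) ->
    exists l : H, forall e : R, 0 < e ->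
      exists n0 : nat, forall n : nat, (n0 <= n)%N -> N (u n - l) < e.

HB.mixin Record Lmodule_isQHilbert (R : realType) H
    & GRing.Lmodule (quat R)^c H := {
  ip : H -> H -> quat R;
  ip_conj : forall u v : H, quat_conj (ip u v) = ip v u;
  ip_gt0 : forall u : H, u != 0 -> exists2 r : R, 0 < r & ip u u = real_quat r;
  ip_rlinear : forall (u v w : H) (p q : quat R),
    ip u (rscale v p + rscale w q) = ip u v * p + ip u w * q;
  ip_complete : norm_complete (hilbert_norm ip)
}.

#[short(type="qhilbertType")]
HB.structure Definition QHilbert (R : realType) :=
  { H of GRing.Lmodule (quat R)^c H & Lmodule_isQHilbert R H }.

Definition hnorm (R : realType) (H : qhilbertType R) (u : H) : R :=
  hilbert_norm (@ip R H) u.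

(* Linearity over (quat R)^c is right linearity. *)
Lemma rlinearP (R : realType) (H : qhilbertType R) (T : {linear H -> H})
  (u v : H) (p : quat R) : T (rscale u p + v) = rscale (T u) p + T v.
Proof. exact: linearP. Qed.

Section Operators.
Variables (R : realType) (H : qhilbertType R).

Definition bounded_op (T : H -> H) : Prop :=
  exists M : R, forall x : H, hnorm (T x) <= M * hnorm x.

(* powR satisfies t `^ 0 = 1 for all t, including t = 0. *)
Definition GCSI (T : H -> H) : Prop :=
  exists alpha beta : R,
    [/\ 0 < beta, beta <= 1, alpha = 1 - beta &
      forall x y : H,
        quat_abs (ip (T x) y) <=
          (hnorm (T x) * hnorm y) `^ alpha * (hnorm (T y) * hnorm x) `^ beta].

Definition paranormal (T : H -> H) : Prop :=
  forall x : H, hnorm (T x) ^+ 2 <= hnorm (T (T x)) * hnorm x.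

End Operators.

(* Main.v *)
(* Put y = Tx in the inequality: with a = ||Tx||^2 and b = ||T^2 x|| ||x|| it
   reads a <= a^(1 - beta) b^beta, and for a > 0 this simplifies to
   a^beta <= b^beta, i.e. a <= b. *)
Require Import Defs.
From mathcomp Require Import all_boot all_order all_algebra.
From mathcomp Require Import reals.
From mathcomp Require Import exp.

Import Order.TTheory GRing.Theory Num.Theory.
Local Open Scope ring_scope.

(** At [y = T x] the left side is the squared norm of [T x] ([quat_abs_ip]), which also appears on
    the right to the power [1 - beta]; [le_powR_split] cancels it. *)

Lemma hnorm_ge0 (R : realType) (H : qhilbertType R) (u : H) : 0 <= hnorm u.
Proof. exact: sqrtr_ge0. Qed.

Lemma ip0r (R : realType) (H : qhilbertType R) (u : H) : ip u 0 = 0.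
Proof.
have := ip_rlinear u 0 0 0 0.
by rewrite /rscale !scaler0 !mulr0 !addr0.
Qed.

Lemma quat_abs_ip (R : realType) (H : qhilbertType R) (u : H) :
  quat_abs (ip u u) = hnorm u ^+ 2.
Proof.
rewrite /quat_abs /hnorm /hilbert_norm /quat_normsq.
(* [ip_gt0] makes [ip u u] real only for nonzero [u]. *)
have [->|/ip_gt0[r r0 ->]] := eqVneq u 0.
  by rewrite ip0r /= !expr0n /= !addr0 sqrtr0 expr0n.
by rewrite /= !expr0n /= !addr0 sqr_sqrtr ?ltW// sqrtr_sqr gtr0_norm.
Qed.

Lemma le_powR_split (R : realType) (a b beta : R) : 0 <= a -> 0 <= b ->
  0 < beta -> a <= a `^ (1 - beta) * b `^ beta -> a <= b.
Proof.
rewrite le_eqVlt => /predU1P[<-//|a0] b0 beta0.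
(* As [a > 0], the factor with exponent [1 - beta] can be cancelled. *)
have {1}-> : a = a `^ (1 - beta) * a `^ beta.
  by rewrite -powRD ?subrK ?powRr1 ?ltW// (gt_eqF a0) implybT.
rewrite ler_pM2l ?powR_gt0// => le_ab.
(* The power [beta > 0] is strictly increasing, so [b < a] is impossible. *)
rewrite leNgt; apply/negP => lt_ba; move: le_ab; apply/negP; rewrite -ltNge.
by apply: gt0_ltr_powR; rewrite ?nnegrE// ltW.
Qed.

Theorem corollary22 (R : realType) (H : qhilbertType R) (T : {linear H -> H}) :
  bounded_op T -> GCSI T -> paranormal T.
Proof.
move=> _ [_ [beta [beta0 _ -> gcsi]]] x.
apply: (@le_powR_split _ _ _ beta); rewrite ?mulr_ge0 ?exprn_ge0 ?hnorm_ge0//.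
by have := gcsi x (T x); rewrite quat_abs_ip -expr2.
Qed.
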